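(* Consider a network setting $(\boldsymbol\mu_i,\gamma_i,\Sigma_i,\Psi_i)_{i\in[n]}$ in which the $\Sigma_i$ are random (symmetric positive definite). Let $Q_i=\Psi_i^T(2\gamma_i\Psi_i\Sigma_i\Psi_i^T)^{-1}\Psi_i$, let $\delta>0$ be the minimum of the union of the nonzero eigenvalues of all the $Q_i$'s, and let $\tilde Q_i=Q_i-\delta I$, so that the distribution of $\{Q_i\}_{i\in[n]}$ corresponds to a distribution over $(\{\tilde Q_i\}_{i\in[n]},\delta)$. If the distribution of $\delta$ given $\{\tilde Q_i\}_{i\in[n]}$ is continuous, then a unique stable point exists with probability $1$.
   Context: $[n]=\{1,\dots,n\}$; $\mathbf e_1,\dots,\mathbf e_n$ is the standard basis of $\mathbb R^n$. A network setting $(\boldsymbol\mu_i,\gamma_i,\Sigma_i,\Psi_i)_{i\in[n]}$ consists, for each agent $i\in[n]$, of a vector $\boldsymbol\mu_i\in\mathbb R^n$, a scalar $\gamma_i>0$, a symmetric positive definite matrix $\Sigma_i\in\mathbb R^{n\times n}$, and a constraint matrix $\Psi_i$ encoding an ordered set $J_i\subseteq[n]$ of agents with whom $i$ may form an edge (where $k\in J_i$ if and only if $i\in J_k$; $i\in J_i$ means the self-loop is permitted): $\Psi_i\in\{0,1\}^{|J_i|\times n}$ is obtained from $I_n$ by deleting the rows not indexed by $J_i$. A pair $(W,P)$ of real $n\times n$ matrices is feasible if $W=W^T$, $P=-P^T$, and $W_{ik}=P_{ik}=0$ whenever $k\notin J_i$. With $\mathbf w_i$ the $i$-th column of $W$,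 agent $i$'s utility is $g_i(W,P)=\mathbf w_i^T(\boldsymbol\mu_i-P\mathbf e_i)-\gamma_i\,\mathbf w_i^T\Sigma_i\mathbf w_i$. A feasible $(W,P)$ is a stable point if for every $i\in[n]$, $g_i(W,P)=\max g_i(W',P)$, the maximum being over all $W'$ such that $(W',P)$ is feasible. *)

(* Defs.v *)
From HB Require Import structures.
From mathcomp Require Import all_boot all_order all_algebra.
From mathcomp Require Import all_classical all_reals all_analysis.

Set Implicit Arguments.
Unset Strict Implicit.
Unset Printing Implicit Defensive.

Import Order.TTheory GRing.Theory Num.Theory.
Local Open Scope classical_set_scope.
Local Open Scope ring_scope.

Definition sym_posdef (R : realType) (n : nat) (A : 'M[R]_n) : Prop :=
  A = A^T /\ forall x : 'cV[R]_n, x != 0 -> 0 < (x^T *m A *m x) 0 0.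

(* The identity with the rows not indexed by J deleted: enum_val lists J in
   increasing order. *)
Definition constraint_mx (R : realType) (n : nat) (J : {set 'I_n})
  : 'M[R]_(#|J|, n) := rowsub (@enum_val _ (mem J)) 1%:M.

(* Agent i's constraint matrix is represented by the set J i that it encodes;
   the vectors mu i are unconstrained. *)
Definition network_setting (R : realType) (n : nat) (J : 'I_n -> {set 'I_n})
    (gamma : 'I_n -> R) (Sigma : 'I_n -> 'M[R]_n) : Prop :=
  [/\ forall i k, k \in J i <-> i \in J k,
      forall i, 0 < gamma i
    & forall i, sym_posdef (Sigma i)].

Definition feasible (R : realType) (n : nat) (J : 'I_n -> {set 'I_n})
    (W P : 'M[R]_n) : Prop :=
  [/\ W = W^T, P = - P^T
    & forall i k, k \notin J i -> W i k = 0 /\ P i k = 0].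

Definition utility (R : realType) (n : nat) (mu : 'I_n -> 'cV[R]_n)
    (gamma : 'I_n -> R) (Sigma : 'I_n -> 'M[R]_n) (i : 'I_n)
    (W P : 'M[R]_n) : R :=
  ((col i W)^T *m (mu i - P *m delta_mx i 0)) 0 0
  - gamma i * ((col i W)^T *m Sigma i *m col i W) 0 0.

Definition stable_point (R : realType) (n : nat) (J : 'I_n -> {set 'I_n})
    (mu : 'I_n -> 'cV[R]_n) (gamma : 'I_n -> R) (Sigma : 'I_n -> 'M[R]_n)
    (W P : 'M[R]_n) : Prop :=
  feasible J W P /\
  forall i (W' : 'M[R]_n), feasible J W' P ->
    utility mu gamma Sigma i W' P <= utility mu gamma Sigma i W P.

Definition Qmx (R : realType) (n : nat) (J : 'I_n -> {set 'I_n})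
    (gamma : 'I_n -> R) (Sigma : 'I_n -> 'M[R]_n) (i : 'I_n) : 'M[R]_n :=
  let Psi := constraint_mx R (J i) in
  Psi^T *m invmx ((2 * gamma i) *: (Psi *m Sigma i *m Psi^T)) *m Psi.

Definition nonzero_spectrum (R : realType) (n : nat) (Q : 'I_n -> 'M[R]_n)
  : set R := [set a | a != 0 /\ exists i, eigenvalue (Q i) a].

Definition is_minimum (R : realType) (A : set R) (m : R) : Prop :=
  A m /\ lbound A m.

(* A family of n matrices as a nested tuple, because tuples carry the product
   Borel sigma-algebra. *)
Definition mxfam_tuple (R : realType) (n : nat) (Q : 'I_n -> 'M[R]_n)
  : n.-tuple (n.-tuple (n.-tuple R)) :=
  [tuple [tuple [tuple Q i j k | k < n] | j < n] | i < n].

(* k is a regular conditional distribution of Y given X. *)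
Definition cond_distribution (R : realType) (d d1 d2 : measure_display)
    (T : measurableType d) (T1 : measurableType d1) (T2 : measurableType d2)
    (Pr : probability T R) (X : T -> T1) (Y : T -> T2)
    (k : R.-pker T1 ~> T2) : Prop :=
  forall (A : set T1) (B : set T2), measurable A -> measurable B ->
    Pr (X @^-1` A `&` Y @^-1` B) = (\int[Pr]_(w in X @^-1` A) k (X w) B)%E.

(* A distribution on the line is continuous when its distribution function is,
   that is, when it has no atom; it need not have a density. Since regular
   conditional distributions on the line exist and are almost surely unique,
   the existential is equivalent to quantifying over all versions. *)
Definition continuous_cond_distribution (R : realType)
    (d d1 : measure_display) (T : measurableType d) (T1 : measurableType d1)
    (Pr : probability T R) (X : T -> T1) (Y : T -> R) : Prop :=
  exists k : R.-pker T1 ~> R,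
    cond_distribution Pr X Y k /\
    {ae Pr, forall w, forall y : R, k (X w) [set y] = 0%E}.

(* Main.v *)
(** For fixed [P], agent [i]'s problem is strictly concave in the column [w_i],
    which ranges over all vectors supported on [J_i]; hence stability means that
    [2 gamma_i Sigma_i w_i + P e_i] agrees with [mu_i] on [J_i] for every [i].
    Feasible pairs are the symmetric and antisymmetric parts of matrices
    supported on [J], so this linear system is square. Its kernel is trivial:
    pairing the homogeneous equations with the [w_i] and summing gives
    [sum_i 2 gamma_i w_i^T Sigma_i w_i + <W, P> = 0], where [<W, P> = 0] because
    [W] is symmetric and [P] antisymmetric, so [W = 0] and then [P = 0].
    Hence a unique stable point exists at every outcome. *)
Require Import Defs.
From HB Require Import structures.
From mathcomp Require Import all_boot all_order all_algebra.
From mathcomp Require Import all_classical all_reals all_analysis.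
From mathcomp Require Import ring lra.
Set Implicit Arguments.
Unset Strict Implicit.
Import Order.TTheory GRing.Theory Num.Theory.
Local Open Scope classical_set_scope.
Local Open Scope ring_scope.

(** Exchanging the two indices turns the sum into its own negative. *)
Lemma sym_antisym_dot0 (R : realType) (n : nat) (W P : 'M[R]_n) :
  W = W^T -> P = - P^T -> \sum_i \sum_k W k i * P k i = 0.
Proof.
move=> WT PT.
suff : \sum_i \sum_k W k i * P k i = - \sum_i \sum_k W k i * P k i by lra.
rewrite {1}exchange_big -sumrN; apply: eq_bigr => i _.
rewrite -sumrN; apply: eq_bigr => k _.
by rewrite {1}WT {1}PT !mxE mulrN.
Qed.

Lemma col_mulmx (R : realType) (m n p : nat) (A : 'M[R]_(m, n))
    (B : 'M[R]_(n, p)) i : col i (A *m B) = A *m col i B.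
Proof. by rewrite !colE mulmxA. Qed.

(** Exact Taylor expansion at [x]: symmetry of [A] merges the two cross terms, so that [h] is paired
    with the gradient at [x]. *)
Lemma quadratic_expansion (R : realType) (n : nat) (A : 'M[R]_n) (c : R)
    (b x h : 'cV[R]_n) : A = A^T ->
  ((x + h)^T *m b) 0 0 - c * ((x + h)^T *m A *m (x + h)) 0 0 =
  (x^T *m b) 0 0 - c * (x^T *m A *m x) 0 0 +
  (h^T *m (b - (2 * c) *: (A *m x))) 0 0 - c * (h^T *m A *m h) 0 0.
Proof.
move=> AT.
have xAh : (x^T *m A *m h) 0 0 = (h^T *m A *m x) 0 0.
  have -> : x^T *m A *m h = (h^T *m A *m x)^T.
    by rewrite !trmx_mul trmxK -AT mulmxA.
  by rewrite mxE.
have addE (M N : 'M[R]_1) : (M + N) 0 0 = M 0 0 + N 0 0 by rewrite mxE.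
have oppE (M : 'M[R]_1) : (- M) 0 0 = - M 0 0 by rewrite mxE.
have scaleE a (M : 'M[R]_1) : (a *: M) 0 0 = a * M 0 0 by rewrite mxE.
rewrite linearD /= !mulmxDl !mulmxDr mulmxN -scalemxAr mulmxA.
rewrite !(addE, oppE, scaleE) xAh; ring.
Qed.

(** Take the maximizer [t = r / (2 * c)] of [t * r - c * t ^+ 2]: the bound becomes
    [r ^+ 2 / (2 * c) <= r ^+ 2 / (4 * c)]. *)
Lemma linear_le_quadratic_eq0 (R : realType) (r c : R) :
  0 < c -> (forall t, t * r <= c * t ^+ 2) -> r = 0.
Proof.
move=> c0 /(_ (r / (2 * c))).
have -> : r / (2 * c) * r = r ^+ 2 / (2 * c) by field; lra.
have -> : c * (r / (2 * c)) ^+ 2 = r ^+ 2 / (2 * c) / 2 by field; lra.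
move=> h; have /eqP : r ^+ 2 / (2 * c) = 0.
  have : 0 <= r ^+ 2 / (2 * c) by rewrite divr_ge0 ?sqr_ge0; lra.
  lra.
by rewrite mulf_eq0 sqrf_eq0 invr_eq0 => /orP[/eqP//|/eqP]; lra.
Qed.

Section Setting.
Context (R : realType) (n : nat) (J : 'I_n -> {set 'I_n}).
Context (mu : 'I_n -> 'cV[R]_n) (gamma : 'I_n -> R) (Sigma : 'I_n -> 'M[R]_n).
Context (setting : network_setting J gamma Sigma).

Lemma feasible_support (W P : 'M[R]_n) i k :
  feasible J W P -> k \notin J i -> W k i = 0 /\ P k i = 0.
Proof.
move=> [WT PT supp] /supp[Wik Pik].
by rewrite WT PT !mxE Wik Pik oppr0.
Qed.

Lemma feasibleB (W P W' P' : 'M[R]_n) :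
  feasible J W P -> feasible J W' P' -> feasible J (W - W') (P - P').
Proof.
move=> [WT PT s] [WT' PT' s']; split.
- by rewrite linearB /= -WT -WT'.
- by rewrite linearB /= opprB {1}PT {1}PT' opprK addrC.
- move=> i k kJ; have [Wik Pik] := s i k kJ; have [W'ik P'ik] := s' i k kJ.
  by rewrite !mxE Wik Pik W'ik P'ik subrr.
Qed.

(** In a network setting, [mu i] minus column [i] of this matrix is the gradient of agent [i]'s
    utility in the column [w_i], with [P] fixed. *)
Definition marginal_cost (W P : 'M[R]_n) : 'M[R]_n :=
  \matrix_(k, i) (2 * gamma i * (Sigma i *m W) k i + P k i).

Lemma marginal_cost_linear (a : R) (W P W' P' : 'M[R]_n) :
  marginal_cost (a *: W + W') (a *: P + P') = a *: marginal_cost W P + marginal_cost W' P'.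
Proof.
by apply/matrixP => k i; rewrite mxE mulmxDr -scalemxAr !mxE; ring.
Qed.

Lemma utilityD (i : 'I_n) (W D P : 'M[R]_n) :
  utility mu gamma Sigma i (W + D) P =
  utility mu gamma Sigma i W P +
  \sum_k D k i * (mu i k 0 - marginal_cost W P k i)
  - gamma i * ((col i D)^T *m Sigma i *m col i D) 0 0.
Proof.
have [_ _ /(_ i)[ST _]] := setting.
rewrite /utility (raddfD (col i)) quadratic_expansion //.
congr (_ + _ - _); rewrite mxE; apply: eq_bigr => k _.
by rewrite -colE -col_mulmx !mxE; congr (_ * _); ring.
Qed.

Lemma stable_pointP (W P : 'M[R]_n) :
  stable_point J mu gamma Sigma W P <->
  feasible J W P /\ forall i k, k \in J i -> marginal_cost W P k i = mu i k 0.
Proof.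
have [Jsym gamma_gt0 Spd] := setting.
split=> [[fWP opt]|[fWP eqs]]; split=> // i.
- move=> k kJ.
  (* Perturb along the single edge between [i] and [k], symmetrically to stay feasible. The
     disjunction, unlike a sum of two unit matrices, makes column [i] equal to [e] even when
     [i = k]. *)
  pose D : 'M[R]_n :=
    \matrix_(a, b) (((a == k) && (b == i)) || ((a == i) && (b == k)))%:R.
  pose e : 'cV[R]_n := delta_mx k 0.
  have colD : col i D = e.
    apply/matrixP => a b; rewrite !mxE ord1 !eqxx !andbT.
    by have [->|ak] := eqVneq a k; have [ai|ai] := eqVneq i k;
      rewrite ?eqxx ?orbF ?andbF //= ?ai ?(negPf ak).
  have fD t : feasible J (W + t *: D) P.
    have [WT PT supp] := fWP; split=> //.
      rewrite linearD /= -WT linearZ /=; congr (_ + _ *: _).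
      by apply/matrixP => a b; rewrite !mxE orbC andbC [X in _ || X]andbC.
    move=> a b bJ; have [Wab Pab] := supp _ _ bJ; rewrite !mxE Wab; split=> //.
    case: (boolP (_ || _)); last by rewrite mulr0 addr0.
    case/orP=> /andP[/eqP ea /eqP eb]; subst a b.
      by move/negP: bJ; case; apply/Jsym.
    by rewrite kJ in bJ.
  have c_gt0 : 0 < gamma i * (e^T *m Sigma i *m e) 0 0.
    rewrite mulr_gt0 //; apply: (Spd i).2.
    by apply/eqP => /matrixP/(_ k 0)/eqP; rewrite !mxE !eqxx oner_eq0.
  suff h t : t * (mu i k 0 - marginal_cost W P k i) <=
     gamma i * (e^T *m Sigma i *m e) 0 0 * t ^+ 2.
    by apply/esym/subr0_eq; exact: linear_le_quadratic_eq0 c_gt0 h.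
  have := opt i _ (fD t); rewrite utilityD.
  have -> : \sum_a (t *: D) a i * (mu i a 0 - marginal_cost W P a i) =
            t * (mu i k 0 - marginal_cost W P k i).
    have DE a : D a i = (a == k)%:R.
      by have /matrixP/(_ a 0) := colD; rewrite !mxE andbT.
    rewrite (bigD1 k) //= big1 ?addr0 => [|a /negPf ak].
      by rewrite mxE DE eqxx mulr1.
    by rewrite mxE DE ak mulr0 mul0r.
  have -> : col i (t *: D) = t *: e by rewrite linearZ /= colD.
  have -> : (t *: e)^T *m Sigma i *m (t *: e) =
            t ^+ 2 *: (e^T *m Sigma i *m e).
    by rewrite [(_ *: _)^T]linearZ /= -!scalemxAl -scalemxAr scalerA.
  rewrite [X in gamma i * X]mxE; lra.
- move=> W' fW'.
  have -> : W' = W + (W' - W) by rewrite addrC subrK.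
  (* The linear term vanishes entrywise: on [J i] by the first-order equations, elsewhere because
     [W] and [W'] are both zero there. What remains is a nonpositive quadratic term. *)
  rewrite utilityD big1 ?addr0 => [|k _].
    have [->|dN0] := eqVneq (col i (W' - W)) 0.
      by rewrite mulmx0 mxE mulr0 subr0.
    have := (Spd i).2 _ dN0; have := gamma_gt0 i => g0 q0.
    by rewrite gerBl mulr_ge0 ?ltW.
  have [kJ|kJ] := boolP (k \in J i); first by rewrite eqs // subrr mulr0.
  by rewrite !mxE (feasible_support fWP kJ).1 (feasible_support fW' kJ).1
    subrr mul0r.
Qed.

Lemma marginal_cost_eq0 (W P : 'M[R]_n) : feasible J W P ->
  (forall i k, k \in J i -> marginal_cost W P k i = 0) -> W = 0 /\ P = 0.
Proof.
move=> fWP eqs; have [WT PT _] := fWP.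
have [_ gamma_gt0 Spd] := setting.
pose q i := ((col i W)^T *m Sigma i *m col i W) 0 0.
have qE i : 2 * gamma i * q i = - \sum_k W k i * P k i.
  apply/eqP; rewrite -addr_eq0 /q -mulmxA -col_mulmx mxE mulr_sumr -big_split /=.
  rewrite big1 // => k _; rewrite !mxE.
  have [/eqs|/(feasible_support fWP)[-> _]] := boolP (k \in J i); last first.
    by rewrite !mul0r mulr0 addr0.
  by rewrite !mxE => e; rewrite mulrCA -mulrDr e mulr0.
have q_ge0 i : 0 <= 2 * gamma i * q i.
  apply: mulr_ge0; first by rewrite ltW // mulr_gt0.
  rewrite /q.
  have [->|/(Spd i).2/ltW//] := eqVneq (col i W) 0.
  by rewrite mulmx0 mxE.
have q_sum0 : \sum_i 2 * gamma i * q i = 0.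
  under eq_bigr do rewrite qE.
  by rewrite sumrN sym_antisym_dot0 // oppr0.
have W0 : W = 0.
  have colW i : col i W = 0.
    apply/eqP; apply/negPn/negP => /(Spd i).2 qi_gt0.
    have : 2 * gamma i * q i = 0.
      exact: (psumr_eq0P (fun j _ => q_ge0 j) q_sum0).
    have : 0 < 2 * gamma i * q i by rewrite mulr_gt0 // mulr_gt0.
    lra.
  by apply/matrixP => k i; have /matrixP/(_ k 0) := colW i; rewrite !mxE.
split=> //; apply/matrixP => k i; rewrite mxE.
have [/eqs|/(feasible_support fWP)[]//] := boolP (k \in J i).
by rewrite mxE W0 mulmx0 mxE mulr0 add0r.
Qed.

Definition mask (X : 'M[R]_n) : 'M[R]_n :=
  \matrix_(k, i) if k \in J i then X k i else 0.

(** Symmetry of the relation [k \in J i] keeps the transpose of [mask X] on the same support.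
    Leaving out the factors 1/2 of the two parts only rescales [X]. *)
Lemma feasible_parts (X : 'M[R]_n) :
  feasible J (mask X + (mask X)^T) (mask X - (mask X)^T).
Proof.
have [Jsym _ _] := setting; split.
- by rewrite linearD /= trmxK addrC.
- by rewrite linearB /= trmxK opprB.
move=> i k kJ; have iJ : i \notin J k by apply: contra kJ => /Jsym.
by rewrite !mxE (negPf kJ) (negPf iJ) addr0 subrr.
Qed.

(* Off the support the identity is used, so that the system is an endomorphism
   of the space of all matrices and injectivity gives surjectivity. *)
Definition system (X : 'M[R]_n) : 'M[R]_n :=
  \matrix_(k, i) if k \in J i
    then marginal_cost (mask X + (mask X)^T) (mask X - (mask X)^T) k i else X k i.

Lemma mask_is_linear : linear mask.
Proof.
move=> a X Y; apply/matrixP => k i; rewrite !mxE.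
by case: ifP => // _; rewrite mulr0 addr0.
Qed.

Lemma system_is_linear : linear system.
Proof.
move=> a X Y; apply/matrixP => k i; rewrite [LHS]mxE mask_is_linear.
have -> : a *: mask X + mask Y + (a *: mask X + mask Y)^T =
          a *: (mask X + (mask X)^T) + (mask Y + (mask Y)^T).
  by apply/matrixP => b c; rewrite !mxE; ring.
have -> : a *: mask X + mask Y - (a *: mask X + mask Y)^T =
          a *: (mask X - (mask X)^T) + (mask Y - (mask Y)^T).
  by apply/matrixP => b c; rewrite !mxE; ring.
rewrite marginal_cost_linear [RHS]mxE [X in _ = X + _]mxE.
rewrite [X in _ = _ * X + _]mxE [X in _ = _ + X]mxE.
by case: ifP => // _; rewrite [LHS]mxE [X in X + _]mxE.
Qed.

HB.instance Definition _ :=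
  GRing.isLinear.Build R 'M[R]_n 'M[R]_n _ system system_is_linear.

Lemma system_inj (X : 'M[R]_n) : system X = 0 -> X = 0.
Proof.
move=> /matrixP sX0; have [|W0 P0] := marginal_cost_eq0 (feasible_parts X).
  by move=> i k kJ; have := sX0 k i; rewrite mxE kJ => ->; rewrite mxE.
apply/matrixP => k i; have := sX0 k i; rewrite mxE mxE.
case: ifP => // kJ _.
(* In the sum of the two entries the transposed terms cancel, leaving [2 * X k i = 0]. *)
have := congr1 (fun M : 'M[R]_n => M k i) W0.
have := congr1 (fun M : 'M[R]_n => M k i) P0.
by rewrite !mxE kJ; lra.
Qed.

Lemma system_surj (Y : 'M[R]_n) : exists X, system X = Y.
Proof.
have ker0 : lker (linfun system) == 0%VS.
  apply/lker0P => X X'; rewrite !lfunE /= => e; apply/eqP.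
  by rewrite -subr_eq0; apply/eqP/system_inj; rewrite linearB /= e subrr.
by exists ((linfun system)^-1%VF Y); rewrite -[LHS]lfunE lker0_lfunVK.
Qed.

Lemma unique_stable_point :
  exists! WP : 'M[R]_n * 'M[R]_n, stable_point J mu gamma Sigma WP.1 WP.2.
Proof.
have [X sX] := system_surj (\matrix_(k, i) mu i k 0).
have st : stable_point J mu gamma Sigma
    (mask X + (mask X)^T) (mask X - (mask X)^T).
  apply/stable_pointP; split=> [|i k kJ]; first exact: feasible_parts.
  by have /matrixP/(_ k i) := sX; rewrite [LHS]mxE [RHS]mxE kJ.
exists (mask X + (mask X)^T, mask X - (mask X)^T); split=> // -[W P] /= st'.
have [f eqs] := (stable_pointP _ _).1 st.
have [f' eqs'] := (stable_pointP _ _).1 st'.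
have [|/eqP + /eqP] := marginal_cost_eq0 (feasibleB f f').
  move=> i k kJ.
  (* Recast the difference as a combination with coefficient -1, so that linearity applies and the
     two copies of [mu] cancel. *)
  rewrite -(scaleN1r W) -(scaleN1r P) ![_ + -1 *: _]addrC marginal_cost_linear.
  by rewrite scaleN1r [LHS]mxE [X in X + _]mxE eqs // eqs' // addNr.
by rewrite !subr_eq0 => /eqP -> /eqP ->.
Qed.

End Setting.

Theorem proposition3 (R : realType) (d : measure_display)
    (T : measurableType d) (Pr : probability T R) (n : nat)
    (J : 'I_n -> {set 'I_n}) (mu : 'I_n -> 'cV[R]_n) (gamma : 'I_n -> R)
    (Sigma : T -> 'I_n -> 'M[R]_n) (delta : T -> R)
    (Sigma_measurable : forall i j k,
       measurable_fun setT (fun w => Sigma w i j k))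
    (setting : forall w, network_setting J gamma (Sigma w))
    (delta_min : forall w,
       is_minimum (nonzero_spectrum (Qmx J gamma (Sigma w))) (delta w))
    (delta_continuous : continuous_cond_distribution Pr
       (fun w => mxfam_tuple (fun i => Qmx J gamma (Sigma w) i - (delta w)%:M))
       delta) :
  let E := [set w | exists! WP : 'M[R]_n * 'M[R]_n,
                      stable_point J mu gamma (Sigma w) WP.1 WP.2] in
  measurable E /\ Pr E = 1%E.
Proof.
(* The deterministic result applies at each outcome, so the event is the whole sample space. *)
have -> : [set w | exists! WP : 'M[R]_n * 'M[R]_n,
    stable_point J mu gamma (Sigma w) WP.1 WP.2] = setT.
  by apply/seteqP; split=> // w _; apply: unique_stable_point.
by split; [exact: measurableT | exact: probability_setT].
Qed.
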